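(* Let $\Lambda$ be any qubit channel whose Choi state has rank two. If one half of the Bell state $|\Phi_1\rangle=\frac{1}{\sqrt2}(|00\rangle+|11\rangle)$ is sent through $\Lambda$, then the final shared state $(\mathbf I\otimes\Lambda)(|\Phi_1\rangle\langle\Phi_1|)$ is not useful for universal quantum teleportation (UQT).
   Context: A qubit channel is a completely positive trace-preserving linear map $\Lambda$ on $2\times2$ complex matrices. Its Choi state is $\rho_{\Lambda,\Phi_1}=(\mathbf I\otimes\Lambda)(|\Phi_1\rangle\langle\Phi_1|)$. If Alice prepares a two-qubit state $\rho$ and sends one half (the second qubit) through $\Lambda$, the final shared state is $(\mathbf I\otimes\Lambda)(\rho)$. Useful for UQT. For a two-qubit density matrix $\rho$ let $T_\rho$ be the real $3\times3$ matrix with entries $T_{ij}=\mathrm{Tr}(\rho\,\sigma_i\otimes\sigma_j)$ ($\sigma_1,\sigma_2,\sigma_3$ the Pauli matrices). By local unitaries $\rho$ can be brought to a canonical form $\rho_C$ with diagonal correlation matrix $\mathrm{diag}(\tau_1,\tau_2,\tau_3)$, $\tau_k=\lambda_k|t_{kk}|$, $\lambda_k\in\{\pm1\}$, where $|t_{11}|,|t_{22}|,|t_{33}|$ are the singular values of $T_\rho$; if $\det T_\rho\le 0$ all $\lambda_k=-1$, and if $\det T_\rho>0$ the $\lambda_k$ equal $-1$ for the two largest $|t_{kk}|$ and $+1$ for the smallest. The maximal average fidelity $F_\rho$ is the average teleportation fidelity (over uniformly distributed pure qubit inputs, standard teleportation protocol, maximized over local unitaries), attained by $\rho_C$, and the fidelity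 deviation $\Delta_\rho$ is the standard deviation over inputs of the fidelity when $\rho_C$ is used; explicitly $F_\rho=\frac12\bigl(1-\frac13\sum_k\tau_k\bigr)$ and $\Delta_\rho=\frac{1}{3\sqrt{10}}\sqrt{\sum_{i<j}(\tau_i-\tau_j)^2}$. The state $\rho$ is useful for UQT if $F_\rho>\frac23$ and $\Delta_\rho=0$; equivalently, $\det T_\rho<0$ and $|t_{11}|=|t_{22}|=|t_{33}|>\frac13$. *)

(* Defs.v *)
(* MathComp world: mathcomp, mathcomp-real-closed and
   mathcomp-analysis. *)
From HB Require Import structures.
From mathcomp Require Export all_boot all_order all_algebra.
From mathcomp Require Export mxtens complex.
From mathcomp Require Export all_classical all_reals all_analysis.

Set Implicit Arguments.
Unset Strict Implicit.
Unset Printing Implicit Defensive.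

Import Order.TTheory GRing.Theory Num.Theory.

Local Open Scope ring_scope.
Local Open Scope complex_scope.
Local Open Scope classical_set_scope.
Local Open Scope sesquilinear_scope.

(* Composite systems use the Kronecker product [*t]; the row of
   |i> (x) |k> in 'M_(m * n) is [mxtens_index (i, k)], i.e. i * n + k. *)

Section Qubits.
Variable R : realType.
Local Notation C := R[i].

Definition ket (i : 'I_2) : 'cV[C]_2 := delta_mx i 0.

Definition proj m (v : 'cV[C]_m) : 'M[C]_m := v *m v ^t*.

Definition pauli (k : 'I_3) : 'M[C]_2 :=
  match val k with
  | 0 => \matrix_(a, b) (a != b)%:R
  | 1 => \matrix_(a, b) (if a == b then 0 else if a == 0 then - 'i else 'i)
  | _ => \matrix_(a, b) (if a != b then 0 else if a == 0 then 1 else - 1)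
  end.

(* The order on R[i] makes [0 <= z] mean that z is real and nonnegative, so
   positive semidefinite matrices are Hermitian. *)
Definition psdmx m (A : 'M[C]_m) : Prop :=
  forall v : 'cV[C]_m, 0 <= (v ^t* *m A *m v) 0 0.

Definition mxtens_block m n (X : 'M[C]_(m * n)) (i j : 'I_m) : 'M[C]_n :=
  \matrix_(a, b) X (mxtens_index (i, a)) (mxtens_index (j, b)).

(* I_m (x) L, where X = \sum_(i, j) |i><j| (x) mxtens_block X i j. *)
Definition id_tens m n (L : 'M[C]_n -> 'M[C]_n) (X : 'M[C]_(m * n)) :
    'M[C]_(m * n) :=
  \sum_(i < m) \sum_(j < m) (delta_mx i j *t L (mxtens_block X i j)).

Definition completely_positive n (L : 'M[C]_n -> 'M[C]_n) : Prop :=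
  forall m (X : 'M[C]_(m * n)), psdmx X -> psdmx (id_tens L X).

Definition trace_preserving n (L : 'M[C]_n -> 'M[C]_n) : Prop :=
  forall X : 'M[C]_n, \tr (L X) = \tr X.

Definition qubit_channel (L : {linear 'M[C]_2 -> 'M[C]_2}) : Prop :=
  completely_positive L /\ trace_preserving L.

(* The types use that 1 * 1 is convertible to 1. *)
Definition Phi1 : 'cV[C]_(2 * 2) :=
  (Num.sqrt 2)^-1%:C *: (ket 0 *t ket 0 + ket 1 *t ket 1).

Definition singlet : 'cV[C]_(2 * 2) :=
  (Num.sqrt 2)^-1%:C *: (ket 0 *t ket 1 - ket 1 *t ket 0).

Definition send_half (L : 'M[C]_2 -> 'M[C]_2) (rho : 'M[C]_(2 * 2)) :
  'M[C]_(2 * 2) := id_tens L rho.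

Definition choi_state (L : 'M[C]_2 -> 'M[C]_2) : 'M[C]_(2 * 2) :=
  send_half L (proj Phi1).

Definition correlation_mx (rho : 'M[C]_(2 * 2)) : 'M[R]_3 :=
  \matrix_(i, j) complex.Re (\tr (rho *m (pauli i *t pauli j))).

Definition local_conj (U V : 'M[C]_2) (rho : 'M[C]_(2 * 2)) : 'M[C]_(2 * 2) :=
  (U *t V) *m rho *m (U *t V) ^t*.

(* Singular values are listed with multiplicity, in any order. *)
Definition singular_values n (T : 'M[R]_n) (t : 'I_n -> R) : Prop :=
  (forall k, 0 <= t k) /\
  char_poly (T^T *m T) = \prod_(k < n) ('X - (t k ^+ 2)%:P).

Definition canonical_sign (T : 'M[R]_3) (t lam : 'I_3 -> R) : Prop :=
  if \det T <= 0 then forall k, lam k = - 1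
  else exists m : 'I_3, (forall k, t m <= t k) /\
                        (forall k, lam k = if k == m then 1 else - 1).

Definition canonical_form (rho rhoC : 'M[C]_(2 * 2)) : Prop :=
  (exists U V : 'M[C]_2,
     [/\ U \is unitarymx, V \is unitarymx & rhoC = local_conj U V rho]) /\
  (exists t lam : 'I_3 -> R,
     [/\ singular_values (correlation_mx rho) t,
         canonical_sign (correlation_mx rho) t lam &
         correlation_mx rhoC = diag_mx (\row_k (lam k * t k))]).

(* The standard protocol is calibrated on the singlet, whose correlation matrix
   is - 1 (the canonical form with t = 1): the outcome k of the Bell measurement
   is the Bell state (correction k (x) I) |singlet>, after which Bob applies
   correction k.  Up to phases,
     |psi> (x) |singlet> = 1/2 \sum_k bell k (x) (correction k |psi>). *)
Definition correction (k : option 'I_3) : 'M[C]_2 :=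
  if k is Some j then pauli j else 1%:M.

Definition bell (k : option 'I_3) : 'cV[C]_(2 * 2) :=
  (correction k *t 1%:M) *m singlet.

(* The Kraus operator of outcome k followed by Bob's correction.  The input
   qubit is the first factor and rho lives on the last two; the types use that
   1 * 2 and (2 * 2) * 2 are convertible to 2 and 2 * (2 * 2), under which
   the Kronecker indexing is associative. *)
Definition teleport_kraus (k : option 'I_3) : 'M[C]_(2, 2 * (2 * 2)) :=
  correction k *m ((bell k) ^t* *t (1%:M : 'M[C]_2)).

Definition teleport_output (rho : 'M[C]_(2 * 2)) (psi : 'cV[C]_2) : 'M[C]_2 :=
  \sum_(k : option 'I_3)
    teleport_kraus k *m (proj psi *t rho) *m (teleport_kraus k) ^t*.

Definition teleport_fidelity (rho : 'M[C]_(2 * 2)) (psi : 'cV[C]_2) : R :=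
  complex.Re ((psi ^t* *m teleport_output rho psi *m psi) 0 0).

Definition bloch_ket (theta phi : R) : 'cV[C]_2 :=
  (cos (theta / 2))%:C *: ket 0
  + ((cos phi +i* sin phi) * (sin (theta / 2))%:C) *: ket 1.

(* Uniform average over pure qubit states: normalized area on the Bloch
   sphere. *)
Definition pure_average (g : 'cV[C]_2 -> R) : R :=
  (4 * pi)^-1 *
  \int[lebesgue_measure]_(phi in `[0, 2 * pi])
    \int[lebesgue_measure]_(theta in `[0, pi])
      (g (bloch_ket theta phi) * sin theta).

Definition average_fidelity (rho : 'M[C]_(2 * 2)) : R :=
  pure_average (teleport_fidelity rho).

Definition max_average_fidelity (rho : 'M[C]_(2 * 2)) : R :=
  sup [set f | exists U V : 'M[C]_2,
    [/\ U \is unitarymx, V \is unitarymx &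
        f = average_fidelity (local_conj U V rho)]].

Definition fidelity_std (rho : 'M[C]_(2 * 2)) : R :=
  Num.sqrt (pure_average (fun psi =>
    (teleport_fidelity rho psi - average_fidelity rho) ^+ 2)).

(* A canonical form always exists, and [fidelity_std] takes the same value on
   all the canonical forms of rho, so this is its fidelity deviation. *)
Definition fidelity_deviation_is (rho : 'M[C]_(2 * 2)) (d : R) : Prop :=
  exists2 rhoC, canonical_form rho rhoC & d = fidelity_std rhoC.

Definition useful_for_UQT (rho : 'M[C]_(2 * 2)) : Prop :=
  2 / 3 < max_average_fidelity rho /\ fidelity_deviation_is rho 0.

End Qubits.

(* Main.v *)
(* Let M be the canonical form of the final state.  Since the channel preserves
   the trace, the first marginal of M is I/2, and vanishing fidelity deviation
   forces the correlation matrix of M to be a scalar t.  Hence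
     4 M = I + t (X (x) X + Y (x) Y + Z (x) Z) + I (x) (r . (X, Y, Z))
   for some Bloch vector r.  If M has rank two, its principal 3 x 3 minors
   vanish, which leaves t = 0 or t = -1; for t = -1 it also gives r = 0, so M is
   the singlet, of rank one.  So t = 0 and M = I (x) P is a product state, as is
   every local-unitary conjugate of it; teleporting through such a state has
   fidelity 1/2 on every input, below the classical bound 2/3. *)
Require Import Defs.
From mathcomp Require Import ring lra.

Set Implicit Arguments.
Unset Strict Implicit.
Unset Printing Implicit Defensive.

Import Order.TTheory GRing.Theory Num.Theory.
Import numFieldNormedType.Exports.

Local Open Scope ring_scope.
Local Open Scope complex_scope.
Local Open Scope classical_set_scope.
Local Open Scope sesquilinear_scope.

Local Notation ent M i a j b := (M (mxtens_index (i, a)) (mxtens_index (j, b))).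

(** * Integrals over the Bloch sphere *)

Lemma derivable_continuous (R : realType) (f : R -> R) :
  (forall x, derivable f x 1) -> continuous f.
Proof. by move=> df x; apply/differentiable_continuous/derivable1_diffP. Qed.

Lemma Rintegral_is_derive (R : realType) (f F : R -> R) (a b : R) :
  a < b -> (forall x, derivable f x 1) ->
  (forall x, is_derive x (1 : R) F (f x)) ->
  \int[lebesgue_measure]_(x in `[a, b]) f x = F b - F a.
Proof.
move=> ab /derivable_continuous cf dF.
have cF : continuous F by apply: derivable_continuous => x; case: (dF x).
rewrite /Rintegral (@continuous_FTC2 R f F a b) //.
- exact: continuous_subspaceT.
- split.
  + by move=> x _; case: (dF x).
  + exact/cvg_at_right_filter/cF.
  + exact/cvg_at_left_filter/cF.
- by move=> x _; rewrite derive1E; case: (dF x).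
Qed.

Lemma Rintegral_sin_even (R : realType) (a b c : R) :
  \int[lebesgue_measure]_(x in `[0, pi])
    ((a + b * cos x ^+ 2 + c * cos x ^+ 4) * sin x)
  = 2 * a + 2 / 3 * b + 2 / 5 * c.
Proof.
(* The antiderivative comes from the substitution u = cos x. *)
pose F (x : R) := - (a * cos x + b / 3 * cos x ^+ 3 + c / 5 * cos x ^+ 5).
have dF x : is_derive x (1 : R) F
    ((a + b * cos x ^+ 2 + c * cos x ^+ 4) * sin x).
  apply: is_derive_eq; rewrite /GRing.scale/=; by field.
rewrite (Rintegral_is_derive _ _ dF) ?pi_gt0//.
  by rewrite /F cospi cos0; field.
Qed.

Lemma Rintegral_cos_even (R : realType) (a b c : R) :
  \int[lebesgue_measure]_(x in `[0, 2 * pi])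
    (a + b * cos x ^+ 2 + c * cos x ^+ 4)
  = pi * (2 * a + b + 3 / 4 * c).
Proof.
(* Antiderivatives of cos^2 and cos^4 from the usual reduction formula. *)
pose F (x : R) := a * x + b / 2 * (x + sin x * cos x)
    + c / 8 * (3 * x + 3 * (sin x * cos x) + 2 * (sin x * cos x ^+ 3)).
have dF x : is_derive x (1 : R) F (a + b * cos x ^+ 2 + c * cos x ^+ 4).
  apply: is_derive_eq; rewrite /GRing.scale/=.
  have s2 : sin x * sin x = 1 - cos x ^+ 2 by rewrite -sin2cos2 expr2.
  by field: s2.
rewrite (Rintegral_is_derive _ _ dF).
- by rewrite /F sin0 mulr_natl sin2pi cos2pi cos0; field.
- by rewrite mulr_gt0 // pi_gt0.
- by move=> x; apply: ex_derive.
Qed.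

(** With n the Bloch vector, the hypothesis makes g equal to a minus half the quadratic form of
    diag(t1, t2, t3) at n. The result is the squared mean plus the variance, and the variance is the
    square of the closed formula for the fidelity deviation. *)
Lemma pure_average_variance (R : realType) (g : 'cV[R[i]]_2 -> R)
    (a t1 t2 t3 : R) :
  (forall theta phi, g (bloch_ket theta phi) =
     a - (sin theta ^+ 2 * (t1 * cos phi ^+ 2 + t2 * sin phi ^+ 2)
          + t3 * cos theta ^+ 2) / 2) ->
  pure_average (fun psi => g psi ^+ 2) =
  (a - (t1 + t2 + t3) / 6) ^+ 2
  + ((t1 - t2) ^+ 2 + (t2 - t3) ^+ 2 + (t1 - t3) ^+ 2) / 90.
Proof.
move=> gE; rewrite /pure_average.
(* With u = cos theta and q = d cos^2 phi / 2, g becomes p - q + (q + r) u^2, an even polynomial in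
   u. *)
pose d := t1 - t2; pose p := a - t2 / 2; pose r := (t2 - t3) / 2.
transitivity ((4 * pi)^-1 * \int[lebesgue_measure]_(phi in `[0, 2 * pi])
   ((2 * p ^+ 2 + 4 / 3 * (p * r) + 2 / 5 * r ^+ 2)
    + (- (4 / 3 * p * d) - 4 / 15 * r * d) * cos phi ^+ 2
    + 4 / 15 * d ^+ 2 * cos phi ^+ 4)).
  congr (_ * _); apply: eq_Rintegral => phi _.
  set q := d * cos phi ^+ 2 / 2.
  transitivity (\int[lebesgue_measure]_(theta in `[0, pi])
    (((p - q) ^+ 2 + 2 * (p - q) * (q + r) * cos theta ^+ 2
     + (q + r) ^+ 2 * cos theta ^+ 4) * sin theta)).
    apply: eq_Rintegral => theta _; rewrite gE !sin2cos2.
    by rewrite /q /p /r /d; field.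
  by rewrite Rintegral_sin_even /q; field.
rewrite Rintegral_cos_even /p /r /d.
by move: pi (lt0r_neq0 (pi_gt0 R)) => P P0; field.
Qed.

Lemma pure_average_cst (R : realType) (g : 'cV[R[i]]_2 -> R) (a : R) :
  (forall theta phi, g (bloch_ket theta phi) = a) -> pure_average g = a.
Proof.
move=> gE; rewrite /pure_average.
transitivity ((4 * pi)^-1 * \int[lebesgue_measure]_(phi in `[0, 2 * pi])
   (2 * a + 0 * cos phi ^+ 2 + 0 * cos phi ^+ 4)).
  congr (_ * _); apply: eq_Rintegral => phi _.
  transitivity (\int[lebesgue_measure]_(theta in `[0, pi])
    ((a + 0 * cos theta ^+ 2 + 0 * cos theta ^+ 4) * sin theta)).
    by apply: eq_Rintegral => theta _; rewrite gE !mul0r !addr0.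
  by rewrite Rintegral_sin_even; field.
rewrite Rintegral_cos_even.
by move: pi (lt0r_neq0 (pi_gt0 R)) => P P0; field.
Qed.

(** * Small sums, Kronecker indices and conjugate transposes *)

Lemma sum_ord2 (V : nmodType) (F : 'I_2 -> V) : \sum_(i < 2) F i = F 0 + F 1.
Proof.
by rewrite !big_ord_recl big_ord0 addr0; congr (F _ + F _); apply: val_inj.
Qed.

Lemma sum_ord3 (V : nmodType) (F : 'I_3 -> V) :
  \sum_(i < 3) F i = F 0 + F 1 + F 2.
Proof.
rewrite !big_ord_recl big_ord0 addr0 addrA.
by congr (F _ + F _ + F _); apply: val_inj.
Qed.

Lemma sum_mxtens_index (V : nmodType) m n (F : 'I_(m * n) -> V) :
  \sum_k F k = \sum_(i < m) \sum_(j < n) F (mxtens_index (i, j)).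
Proof.
rewrite pair_big (reindex (@mxtens_index m n)) /=; last first.
  apply: onW_bij; exists (@mxtens_unindex m n).
    exact: mxtens_indexK.
  exact: mxtens_unindexK.
by apply: eq_bigr => -[].
Qed.

(** Stated in [nat] because the two indices live in different ordinal types. *)
Lemma mxtens_indexA m n p (i : 'I_m) (j : 'I_n) (k : 'I_p) :
  mxtens_index (mxtens_index (i, j), k) =
  mxtens_index (i, mxtens_index (j, k)) :> nat.
Proof. by rewrite /= mulnDl -mulnA addnA. Qed.

Lemma sum_option (V : nmodType) (T : finType) (F : option T -> V) :
  \sum_k F k = F None + \sum_k F (Some k).
Proof.
rewrite (bigD1 None) //= (reindex_omap Some id) => [|[]//].
by congr (_ + _); apply: eq_bigl => k /=; rewrite eqxx.
Qed.

Lemma trmxC_mul (C : numClosedFieldType) m n p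
    (A : 'M[C]_(m, n)) (B : 'M[C]_(n, p)) :
  (A *m B)^t* = B^t* *m A^t*.
Proof. by rewrite trmx_mul map_mxM. Qed.

Lemma trmxC_tens (C : numClosedFieldType) m n p q
    (A : 'M[C]_(m, n)) (B : 'M[C]_(p, q)) :
  (A *t B)^t* = A^t* *t B^t*.
Proof. by rewrite trmx_tens map_mxT. Qed.

Lemma trmxC1 (C : numClosedFieldType) n : (1%:M : 'M[C]_n)^t* = 1%:M.
Proof. by rewrite trmx1 map_mx1. Qed.

Lemma unitarymx_mulV (C : numClosedFieldType) n (U : 'M[C]_n) :
  U \is unitarymx -> U^t* *m U = 1%:M.
Proof. by move=> /unitarymxP; apply: mulmx1C. Qed.

(** * Teleportation fidelity as a quadratic form in the shared state *)

Section Teleportation.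
Variable R : realType.
Local Notation C := R[i].
Implicit Types (rho : 'M[C]_(2 * 2)) (psi : 'cV[C]_2).

(** The bra <psi| K_k (|psi> (x) I) on the shared pair: evaluating rho at it gives the part of the
    fidelity due to outcome k. *)
Definition teleport_row (k : option 'I_3) psi : 'rV[C]_(2 * 2) :=
  psi^t* *m teleport_kraus R k *m (psi *t (1%:M : 'M[C]_(2 * 2))).

Lemma tens1mx rho : (1%:M : 'M[C]_1) *t rho = rho.
Proof.
have E (k : 'I_(2 * 2)) : k = mxtens_index ((0 : 'I_1), k) :> 'I_(1 * (2 * 2)).
  exact: val_inj.
apply/matrixP => i j.
by rewrite [in LHS](E i) [in LHS](E j) tensmxE mxE eqxx mul1r.
Qed.

(** Isolates rho between two operators that depend on psi only, ready to be merged with the Kraus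
    operators. *)
Lemma proj_tens psi rho :
  proj psi *t rho =
  (psi *t (1%:M : 'M[C]_(2 * 2))) *m rho *m (psi *t (1%:M : 'M[C]_(2 * 2)))^t*.
Proof.
rewrite /proj -[rho in LHS]mulmx1 -tensmx_mul trmxC_tens trmxC1.
congr (_ *m _); rewrite -[rho in LHS]mul1mx -[psi in LHS]mulmx1 -tensmx_mul.
by rewrite tens1mx.
Qed.

Lemma teleport_fidelityE rho psi :
  teleport_fidelity rho psi =
  complex.Re
    (\sum_k (teleport_row k psi *m rho *m (teleport_row k psi)^t*) 0 0).
Proof.
rewrite /teleport_fidelity /teleport_output mulmx_sumr mulmx_suml summxE.
congr (complex.Re _); apply: eq_bigr => k _; congr (fun_of_matrix _ 0 0).
rewrite proj_tens /teleport_row; set K := teleport_kraus _ _; set J := psi *t _.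
by rewrite (trmxC_mul (_ *m _) J) (trmxC_mul _ K) trmxCK !mulmxA.
Qed.

(** The Kraus operator groups its three qubits as (2 * 2) * 2, the input as 2 * (2 * 2); here its
    entries are read in the second grouping. *)
Lemma tensmx1E (u : 'rV[C]_(2 * 2)) (a b c d : 'I_2) :
  (u *t (1%:M : 'M[C]_2) : 'M[C]_(2, 2 * (2 * 2))) d
    (mxtens_index (a, mxtens_index (c, b))) =
  u 0 (mxtens_index (a, c)) * (d == b)%:R.
Proof.
have -> : mxtens_index (a, mxtens_index (c, b)) =
    mxtens_index (mxtens_index (a, c), b) :> 'I_(2 * (2 * 2)).
  exact/val_inj/esym/mxtens_indexA.
have -> : d = mxtens_index ((0 : 'I_1), d) :> 'I_(1 * 2) by apply: val_inj.
apply: etrans (tensmxE u 1%:M 0 d (mxtens_index (a, c)) b) _.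
by rewrite mxE; congr (_ * (_ == _)%:R); apply: val_inj.
Qed.

(** Bob's index b meets only the correction and the index c of Alice's half meets only the Bell
    vector, so each entry is a product. *)
Lemma teleport_rowE k psi c b :
  teleport_row k psi 0 (mxtens_index (c, b)) =
  (\sum_i (psi i 0)^*%C * correction R k i b) *
  (\sum_i psi i 0 *
     (\sum_j correction R k i j * singlet R (mxtens_index (j, c)) 0)^*%C).
Proof.
rewrite /teleport_row /teleport_kraus mulmxA.
have bE a : bell R k (mxtens_index (a, c)) 0 =
    \sum_j correction R k a j * singlet R (mxtens_index (j, c)) 0.
  rewrite mxE sum_mxtens_index; apply: eq_bigr => j _.
  rewrite (bigD1 c) //= tensmxE mxE eqxx mulr1.
  rewrite big1 ?addr0 // => d /negPf dc.
  by rewrite tensmxE [1%:M _ _]mxE eq_sym dc mulr0 mul0r.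
have colE a x :
    (psi *t (1%:M : 'M[C]_(2 * 2))) (mxtens_index (a, x)) (mxtens_index (c, b))
    = psi a 0 * (x == mxtens_index (c, b))%:R.
  have -> : mxtens_index (c, b) =
      mxtens_index ((0 : 'I_1), mxtens_index (c, b)) :> 'I_(1 * (2 * 2)).
    exact: val_inj.
  rewrite tensmxE [1%:M _ _]mxE; congr (_ * (_ == _)%:R); exact: val_inj.
have rowE a :
    (psi^t* *m correction R k *m
       ((bell R k)^t* *t (1%:M : 'M[C]_2) : 'M[C]_(2, 2 * (2 * 2))))
      0 (mxtens_index (a, mxtens_index (c, b))) =
    (\sum_i (psi i 0)^*%C * correction R k i b)
    * (bell R k (mxtens_index (a, c)) 0)^*%C.
  rewrite mxE (bigD1 b) //= big1 ?addr0 => [|d /negPf db]; last first.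
    by rewrite tensmx1E db !mulr0.
  rewrite tensmx1E eqxx mulr1 !mxE; congr (_ * _).
  by apply: eq_bigr => i _; rewrite !mxE.
rewrite mxE sum_mxtens_index [RHS]mulr_sumr; apply: eq_bigr => a _.
rewrite (bigD1 (mxtens_index (c, b))) //= big1 ?addr0 => [|x /negPf xcb];
  last first.
  by rewrite colE xcb mulr0 mulr0.
by rewrite colE eqxx mulr1 rowE bE mulrAC mulrA.
Qed.

End Teleportation.

(** * Contribution of a single measurement outcome *)

Section TeleportationEntries.
Variable R : realType.
Local Notation C := R[i].
Implicit Types (rho : 'M[C]_(2 * 2)) (psi : 'cV[C]_2).

Lemma quadratic_formE (M : 'M[C]_(2 * 2)) (r : 'rV[C]_(2 * 2)) :
  (r *m M *m r^t*) 0 0 =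
  \sum_(j < 2) \sum_(b < 2) (\sum_(i < 2) \sum_(a < 2)
    r 0 (mxtens_index (i, a)) * ent M i a j b) * (r 0 (mxtens_index (j, b)))^*%C.
Proof.
rewrite mxE sum_mxtens_index; apply: eq_bigr => j _; apply: eq_bigr => b _.
by rewrite !mxE sum_mxtens_index.
Qed.

Lemma tens_colE (u v : 'cV[C]_2) (i j : 'I_2) :
  (u *t v : 'cV[C]_(2 * 2)) (mxtens_index (i, j)) 0 = u i 0 * v j 0.
Proof.
by rewrite -(tensmxE u v i j 0 0); congr (fun_of_matrix _ _ _); apply: val_inj.
Qed.

Lemma singletE (i j : 'I_2) :
  singlet R (mxtens_index (i, j)) 0 =
  (Num.sqrt 2)^-1%:C *
  (((i == 0) && (j == 1))%:R - ((i == 1) && (j == 0))%:R).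
Proof.
rewrite /singlet [LHS]mxE [X in _ * X]mxE [X in _ * (_ + X)]mxE.
by rewrite !tens_colE !mxE !andbT -!natrM !mulnb.
Qed.

Lemma singlet_conj (i j : 'I_2) :
  (singlet R (mxtens_index (i, j)) 0)^*%C = singlet R (mxtens_index (i, j)) 0.
Proof.
rewrite singletE rmorphM rmorphB /= !conjc_nat; congr (_ * _); exact: conjc_real.
Qed.

Definition isqrt2 : C := (Num.sqrt 2)^-1%:C.

Lemma singlet_vals : [/\ singlet R (mxtens_index (0, 0)) 0 = 0,
  singlet R (mxtens_index (0, 1)) 0 = isqrt2,
  singlet R (mxtens_index (1, 0)) 0 = - isqrt2 &
  singlet R (mxtens_index (1, 1)) 0 = 0].
Proof.
split; rewrite singletE /= /isqrt2.
all: by rewrite ?(subrr, subr0, sub0r) ?(mulr0, mulr1, mulrN1).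
Qed.

Lemma teleport_row_vals k psi (c : 'I_2) :
  let u := (psi 0 0)^*%C in let v := (psi 1 0)^*%C in
  let s := correction R k in
  teleport_row k psi 0 (mxtens_index (0, c)) =
  - isqrt2 * (u * s 0 c + v * s 1 c) *
    (psi 0 0 * (s 0 1)^*%C + psi 1 0 * (s 1 1)^*%C) /\
  teleport_row k psi 0 (mxtens_index (1, c)) =
  isqrt2 * (u * s 0 c + v * s 1 c) *
    (psi 0 0 * (s 0 0)^*%C + psi 1 0 * (s 1 0)^*%C).
Proof.
move=> u v s.
have [s00 s01 s10 s11] := singlet_vals.
split; rewrite teleport_rowE !sum_ord2 !rmorphD !rmorphM /= !singlet_conj
  ?s00 ?s01 ?s10 ?s11.
  by rewrite /s /u /v; ring.
by rewrite /s /u /v; ring.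
Qed.

Lemma isqrt2_sq : isqrt2 * isqrt2 = 2^-1.
Proof.
by rewrite /isqrt2 -rmorphM -invfM -expr2 sqr_sqrtr ?ler0n // fmorphV rmorph_nat.
Qed.

Lemma correction_herm k i j : (correction R k i j)^*%C = correction R k j i.
Proof.
case: k i j => [[[|[|[|//]]] ?]|] [[|[|//]] ?] [[|[|//]] ?]; rewrite !mxE /=;
  by apply/eqP; rewrite eq_complex /= ?oppr0 ?opprK !eqxx.
Qed.

Definition corrected k psi i : C := (correction R k *m psi) i 0.

(* The corrections are Hermitian, so outcome k acts on psi as outcome None acts
   on [correction k *m psi]. *)
Lemma teleport_row_corrected k psi b :
  teleport_row k psi 0 (mxtens_index (0, b)) =
    - isqrt2 * corrected k psi 1 * (corrected k psi b)^*%C /\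
  teleport_row k psi 0 (mxtens_index (1, b)) =
    isqrt2 * corrected k psi 0 * (corrected k psi b)^*%C.
Proof.
have [-> ->] := teleport_row_vals k psi b.
rewrite /corrected !mxE !sum_ord2 !correction_herm rmorphD !rmorphM /=.
rewrite !correction_herm.
by split; ring.
Qed.

(** With phi = (x, y) the corrected input, the row is 1 / sqrt 2 times the bra of phi' (x) phi,
    where phi' = (-v, u) is orthogonal to phi. Orthogonality on Alice's side reflects the
    calibration on the singlet. *)
Lemma teleport_form k rho psi :
  let x := corrected k psi 0 in let y := corrected k psi 1 in
  let u := x^*%C in let v := y^*%C in
  (teleport_row k psi *m rho *m (teleport_row k psi)^t*) 0 0 = 2^-1 * (
     (y * u * ent rho 0 0 0 0 + y * v * ent rho 0 1 0 0
       - x * u * ent rho 1 0 0 0 - x * v * ent rho 1 1 0 0) * (v * x)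
   + (y * u * ent rho 0 0 0 1 + y * v * ent rho 0 1 0 1
       - x * u * ent rho 1 0 0 1 - x * v * ent rho 1 1 0 1) * (v * y)
   - (y * u * ent rho 0 0 1 0 + y * v * ent rho 0 1 1 0
       - x * u * ent rho 1 0 1 0 - x * v * ent rho 1 1 1 0) * (u * x)
   - (y * u * ent rho 0 0 1 1 + y * v * ent rho 0 1 1 1
       - x * u * ent rho 1 0 1 1 - x * v * ent rho 1 1 1 1) * (u * y)).
Proof.
move=> x y u v.
have row b := teleport_row_corrected k psi b.
have row0 b := (row b).1; have row1 b := (row b).2.
rewrite quadratic_formE !sum_ord2 !{}row0 !{}row1 {row} -/x -/y -/u -/v.
have hJ : isqrt2^*%C = isqrt2 by exact: conjc_real.
rewrite -isqrt2_sq; move: isqrt2 hJ => h hJ.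
rewrite !rmorphM !rmorphN /= hJ !conjcK -/u -/v.
ring.
Qed.

End TeleportationEntries.

(** * Fidelity as a function of the Bloch angles *)

Section BlochFidelity.
Variable R : realType.
Local Notation C := R[i].
Implicit Types (rho : 'M[C]_(2 * 2)) (psi : 'cV[C]_2).

Lemma correctedE psi (x := psi 0 0) (y := psi 1 0) :
  [/\ corrected None psi 0 = x /\ corrected None psi 1 = y,
      corrected (Some 0) psi 0 = y /\ corrected (Some 0) psi 1 = x,
      corrected (Some 1) psi 0 = - 'i%C * y /\
      corrected (Some 1) psi 1 = 'i%C * x &
      corrected (Some 2) psi 0 = x /\ corrected (Some 2) psi 1 = - y].
Proof.
by split; rewrite /corrected !mxE !sum_ord2 /= !mxE /=;
  rewrite ?(mulr0n, mulr1n, mulr0, mul0r, addr0, add0r, mul1r, mulN1r).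
Qed.

(** Summing over the four Pauli corrections twirls rho: all entries cancel except those on the
    diagonal and the antidiagonal. *)
Lemma teleport_fidelity_ent rho psi :
  let x := psi 0 0 in let y := psi 1 0 in let u := x^*%C in let v := y^*%C in
  teleport_fidelity rho psi = complex.Re (
    2 * (x * u * y * v) * (ent rho 0 0 0 0 + ent rho 1 1 1 1)
    + ((x * u) ^+ 2 + (y * v) ^+ 2) * (ent rho 0 1 0 1 + ent rho 1 0 1 0)
    - 2 * (x * u * y * v) * (ent rho 0 1 1 0 + ent rho 1 0 0 1)
    - ((y * u) ^+ 2 + (x * v) ^+ 2) * (ent rho 0 0 1 1 + ent rho 1 1 0 0)).
Proof.
move=> x y u v; rewrite teleport_fidelityE; congr (complex.Re _).
rewrite (eq_bigr _ (fun k _ => teleport_form k rho psi)) /= sum_option sum_ord3.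
have [[-> ->] [-> ->] [-> ->] [-> ->]] := correctedE psi.
have iJ : ('i%C : C)^*%C = - 'i%C.
  by apply/eqP; rewrite eq_complex /= oppr0 !eqxx.
have ii : 'i%C * 'i%C = -1 :> C by rewrite -expr2 sqr_i.
(* The imaginary unit becomes a variable of which only the conjugate and the square are kept, so
   that [field] can decide the identity. *)
move: ('i%C : C) iJ ii => i iJ ii.
rewrite !rmorphM !rmorphN /= iJ -/x -/y -/u -/v.
by field: ii.
Qed.

(** Every coefficient in the entry formula is real, so only real parts of entries survive, and phi
    enters only through cos (2 phi). *)
Lemma teleport_fidelity_bloch rho (theta phi : R) :
  let re i a j b := complex.Re (ent rho i a j b) in
  teleport_fidelity rho (bloch_ket theta phi) =
  (sin theta ^+ 2 * (re 0 0 0 0 + re 1 1 1 1 - (re 0 1 1 0 + re 1 0 0 1)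
       - (cos phi ^+ 2 - sin phi ^+ 2) * (re 0 0 1 1 + re 1 1 0 0))
   + (1 + cos theta ^+ 2) * (re 0 1 0 1 + re 1 0 1 0)) / 2.
Proof.
move=> re; rewrite teleport_fidelity_ent /re.
have -> : bloch_ket theta phi 0 0 = (cos (theta / 2))%:C.
  by rewrite /bloch_ket !mxE /= mulr1 mulr0 addr0.
have -> : bloch_ket theta phi 1 0 =
    (cos phi +i* sin phi) * (sin (theta / 2))%:C.
  by rewrite /bloch_ket !mxE /= mulr1 mulr0 add0r.
(* The ket carries theta / 2, so theta is split for the addition formulas. *)
have thetaE : theta = theta / 2 + theta / 2 by field.
rewrite [in sin theta]thetaE [in cos theta]thetaE sinD cosD.
have cp : cos phi ^+ 2 = 1 - sin phi ^+ 2 by rewrite cos2sin2.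
have ct : cos (theta / 2) ^+ 2 = 1 - sin (theta / 2) ^+ 2.
  by rewrite cos2sin2.
move: (cos (theta / 2)) (sin (theta / 2)) (cos phi) (sin phi) cp ct {thetaE re}.
move=> c s a b cp ct.
move: (ent rho 0 0 0 0) (ent rho 1 1 1 1) (ent rho 0 1 0 1) (ent rho 1 0 1 0)
 (ent rho 0 1 1 0) (ent rho 1 0 0 1) (ent rho 0 0 1 1) (ent rho 1 1 0 0).
move=> [e1 f1] [e2 f2] [e3 f3] [e4 f4] [e5 f5] [e6 f6] [e7 f7] [e8 f8] /=.
by field: cp ct.
Qed.
End BlochFidelity.

(** * Three by three minors and the rank *)

Lemma det_mx33 (K : comPzRingType) (A : 'M[K]_3) :
  \det A = A 0 0 * (A 1 1 * A 2 2 - A 1 2 * A 2 1)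
         - A 0 1 * (A 1 0 * A 2 2 - A 1 2 * A 2 0)
         + A 0 2 * (A 1 0 * A 2 1 - A 1 1 * A 2 0).
Proof.
(* Entries are read through a function on [nat], so that lifted ordinals and numerals compute to the
   same index. *)
have [a aE] : exists a : nat -> nat -> K, forall i j, A i j = a i j.
  by exists (fun i j => A (inord i) (inord j)) => i j; rewrite !inord_val.
rewrite (expand_det_row _ 0) sum_ord3 /cofactor.
rewrite !(expand_det_row _ 0) !sum_ord2 /cofactor !det_mx11 !mxE !aE /=.
rewrite /bump /=; ring.
Qed.

(** A nonzero minor would be an invertible submatrix of rank 3, and selecting rows or columns never
    raises the rank. *)
Lemma minor3_eq0 (K : fieldType) m n (A : 'M[K]_(m, n))
    (f : 'I_3 -> 'I_m) (g : 'I_3 -> 'I_n) :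
  (\rank A < 3)%N -> \det (mxsub f g A) = 0.
Proof.
apply: contraTeq => d0; rewrite -leqNgt.
rewrite -[leqLHS](@mxrank_unit _ _ (mxsub f g A)) ?unitmxE ?unitfE //.
rewrite mxsubrc (leq_trans (mxrankS (rowsub_sub _ _))) //.
by rewrite -[A in colsub g A]mulmx1 -mulmx_colsub mxrankM_maxl.
Qed.

(** * States with a diagonal correlation matrix *)

Section States.
Variable R : realType.
Local Notation C := R[i].
Implicit Types (rho : 'M[C]_(2 * 2)).

(** Polarization: the form is real at e_i + c e_j. Taking c = 1 and c = -1 gives opposite imaginary
    parts, and c = 'i then gives equal real parts. *)
Lemma psdmx_hermitian n (A : 'M[C]_n) i j : psdmx A -> (A j i)^*%C = A i j.
Proof.
move=> psdA.
have q (c : C) : complex.Im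
    (A i i + c * A i j + c^*%C * A j i + c * c^*%C * A j j) = 0.
  have /ger0_Im <- := psdA (delta_mx i 0 + c *: delta_mx j 0).
  congr complex.Im.
  have -> : (delta_mx i 0 + c *: delta_mx j 0 : 'cV[C]_n)^t* =
      delta_mx 0 i + c^*%C *: delta_mx 0 j.
    apply/matrixP => x y; rewrite !mxE rmorphD rmorphM /= !rmorph_nat.
    by rewrite !(andbC (x == 0)).
  rewrite mulmxDl mulmxDr mulmxDl mulmxDl -!scalemxAr -!scalemxAl.
  rewrite -!rowE -!colE !mxE; ring.
have := (q (-1), q 1, q 'i%C); rewrite !rmorphN !rmorph1 /=.
case: (A i i) (A j j) (A i j) (A j i) => [a b] [c d] [e f] [g h] /= [[e1 e2] e3].
by apply/eqP; rewrite eq_complex /=; apply/andP; split; apply/eqP; lra.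
Qed.

Lemma tr_tens (M : 'M[C]_(2 * 2)) (A B : 'M[C]_2) :
  \tr (M *m (A *t B)) = \sum_(i < 2) \sum_(a < 2) \sum_(j < 2) \sum_(b < 2)
    ent M i a j b * (A j i * B b a).
Proof.
rewrite /mxtrace sum_mxtens_index; apply: eq_bigr => i _; apply: eq_bigr => a _.
rewrite mxE sum_mxtens_index; apply: eq_bigr => j _; apply: eq_bigr => b _.
by rewrite tensmxE.
Qed.

(** The marginal is Alice's: the second qubit, held by Bob, is traced out. *)
Definition maximally_mixed_marginal rho : Prop :=
  forall i j : 'I_2,
    ent rho i 0 j 0 + ent rho i 1 j 1 = ((i == j)%:R / 2)%:C.

(** Of the 16 real parameters of a Hermitian rho, the marginal fixes four and the correlations nine.
    The other three are Bob's Bloch vector r, with s = r_z, p = r_x / 4 and q = - r_y / 4. *)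
Lemma canonical_entries rho (t : 'I_3 -> R) :
  (forall x y, (rho y x)^*%C = rho x y) ->
  maximally_mixed_marginal rho ->
  (forall i j, correlation_mx rho i j = t i *+ (i == j)) ->
  exists (s p q : R), let z := p +i* q in
  [/\ 
  [/\ ent rho 0 0 0 0 = ((1 + t 2 + s) / 4)%:C, ent rho 0 0 0 1 = z,
      ent rho 0 0 1 0 = 0 & ent rho 0 0 1 1 = ((t 0 - t 1) / 4)%:C],
  [/\ ent rho 0 1 0 0 = z^*, ent rho 0 1 0 1 = ((1 - t 2 - s) / 4)%:C,
      ent rho 0 1 1 0 = ((t 0 + t 1) / 4)%:C & ent rho 0 1 1 1 = 0],
  [/\ ent rho 1 0 0 0 = 0, ent rho 1 0 0 1 = ((t 0 + t 1) / 4)%:C,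
      ent rho 1 0 1 0 = ((1 - t 2 + s) / 4)%:C & ent rho 1 0 1 1 = z] &
  [/\ ent rho 1 1 0 0 = ((t 0 - t 1) / 4)%:C, ent rho 1 1 0 1 = 0,
      ent rho 1 1 1 0 = z^* & ent rho 1 1 1 1 = ((1 + t 2 - s) / 4)%:C]].
Proof.
move=> herm ptr corr.
have c k l :
    complex.Re (\tr (rho *m (pauli R k *t pauli R l))) = t k *+ (k == l).
  by rewrite -corr mxE.
have simp := (mulr0, mul0r, mulr1, mul1r, addr0, add0r).
have c00 := c 0 0; rewrite tr_tens !sum_ord2 !mxE /= ?simp in c00.
have c01 := c 0 1; rewrite tr_tens !sum_ord2 !mxE /= ?simp in c01.
have c02 := c 0 2; rewrite tr_tens !sum_ord2 !mxE /= ?simp in c02.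
have c10 := c 1 0; rewrite tr_tens !sum_ord2 !mxE /= ?simp in c10.
have c11 := c 1 1; rewrite tr_tens !sum_ord2 !mxE /= ?simp in c11.
have c12 := c 1 2; rewrite tr_tens !sum_ord2 !mxE /= ?simp in c12.
have c20 := c 2 0; rewrite tr_tens !sum_ord2 !mxE /= ?simp in c20.
have c21 := c 2 1; rewrite tr_tens !sum_ord2 !mxE /= ?simp in c21.
have c22 := c 2 2; rewrite tr_tens !sum_ord2 !mxE /= ?simp in c22.
move: c00 c01 c02 c10 c11 c12 c20 c21 c22 {c corr}.
have := (ptr 0 0, ptr 0 1, ptr 1 1) => /=.
have hE i a j b : (ent rho j b i a)^*%C = ent rho i a j b by exact: herm.
have := (hE 0 0 0 0, hE 0 1 0 1, hE 1 0 1 0, hE 1 1 1 1).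
rewrite -(hE 0 1 0 0) -(hE 1 0 0 0) -(hE 1 0 0 1).
rewrite -(hE 1 1 0 0) -(hE 1 1 0 1) -(hE 1 1 1 0).
move: (ent rho 0 0 0 0) (ent rho 0 1 0 1) (ent rho 1 0 1 0) (ent rho 1 1 1 1)
  (ent rho 0 0 0 1) (ent rho 0 0 1 0) (ent rho 0 0 1 1) (ent rho 0 1 1 0)
  (ent rho 0 1 1 1) (ent rho 1 0 1 1).
move=> [a a'] [b b'] [c c'] [d d'] [e e'] [f f'] [g g'] [h h'] [k k'] [l l'] /=.
move=> [[[[d1] [d2]] [d3]] [d4]] [[[p1 p1'] [p2 p2']] [p3 p3']].
move=> c1 c2 c3 c4 c5 c6 c7 c8 c9.
(* In the sum a + c of two diagonal entries t 2 cancels, leaving (1 + s) / 2. *)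
exists (2 * (a + c) - 1), e, e'.
do 2 split; apply/eqP; rewrite eq_complex /=; apply/andP; split.
all: by apply/eqP; lra.
Qed.
End States.

(** * Rank-two states with scalar correlations *)

(** The equations say that the four principal 3 x 3 minors vanish: a1, b1, b2, a2 are four times the
    diagonal entries and Z is 16 |z|^2. The split is on the corners a1 and a2; only when both vanish
    does t = -1 occur. *)
Lemma isotropic_minors (F : realFieldType) (t s p q : F)
    (Z := 16 * (p ^+ 2 + q ^+ 2)) (a1 := 1 + t + s) (a2 := 1 + t - s)
    (b1 := 1 - t - s) (b2 := 1 - t + s) :
  a2 * (a1 * b1 - Z) = 0 -> a1 * (b2 * a2 - Z) = 0 ->
  b1 * (b2 * a2 - Z) = 4 * t ^+ 2 * a2 ->
  b2 * (a1 * b1 - Z) = 4 * t ^+ 2 * a1 ->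
  t = 0 \/ [/\ t = -1, s = 0, p = 0 & q = 0].
Proof.
move=> E1 E2 E3 E4.
have [a20|a2n0] := eqVneq a2 0; have [a10|a1n0] := eqVneq a1 0.
- have [tE sE] : t = -1 /\ s = 0.
    by clear E1 E2 E3 E4; split; move: a10 a20; rewrite /a1 /a2; lra.
  have Z0 : Z = 0 by move: E3; rewrite a20 /b1 tE sE; lra.
  have := sqr_ge0 p; have := sqr_ge0 q; rewrite /Z in Z0 => q2 p2.
  clear E1 E2 E3 E4; right; split=> //.
    by apply/eqP; rewrite -sqrf_eq0; apply/eqP; lra.
  by apply/eqP; rewrite -sqrf_eq0; apply/eqP; lra.
- left; have Z0 : Z = 0.
    move/eqP: E2; rewrite mulf_eq0 (negPf a1n0) a20 mulr0 sub0r oppr_eq0.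
    by move/eqP.
  have : b2 * b1 = 4 * t ^+ 2.
    by apply: (mulIf a1n0); rewrite -E4 Z0; ring.
  have sE : s = 1 + t by move: a20; rewrite /a2; lra.
  (* Here b1 = -2 t and b2 = 2, so -4 t = 4 t^2; the root t = -1 would force a1 = 0. *)
  move=> H; have /eqP : t * (1 + t) = 0 by move: H; rewrite /b1 /b2 sE; lra.
  rewrite mulf_eq0 => /orP[/eqP //|/eqP t1].
  by move/eqP: a1n0; rewrite /a1 sE; lra.
- left; have Z0 : Z = 0.
    move/eqP: E1; rewrite mulf_eq0 (negPf a2n0) a10 mul0r sub0r oppr_eq0.
    by move/eqP.
  have : b2 * b1 = 4 * t ^+ 2.
    by apply: (mulIf a2n0); rewrite -E3 Z0; ring.
  have sE : s = - (1 + t) by move: a10; rewrite /a1; lra.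
  move=> H; have /eqP : t * (1 + t) = 0 by move: H; rewrite /b1 /b2 sE; lra.
  rewrite mulf_eq0 => /orP[/eqP //|/eqP t1].
  by move/eqP: a2n0; rewrite /a2 sE; lra.
(* Both corners are nonzero: the first equation gives a1 b1 = Z, and the last becomes 0 = 4 t^2
   a1. *)
- left; move/eqP: E1; rewrite mulf_eq0 (negPf a2n0) => /eqP Z0.
  move/esym/eqP: E4; rewrite Z0 mulr0 !mulf_eq0 (negPf a1n0) orbF orbb.
  by rewrite pnatr_eq0 => /eqP.
Qed.

Section Rank.
Variable R : realType.
Local Notation C := R[i].
Implicit Types (rho : 'M[C]_(2 * 2)).

Lemma projE n (v : 'cV[C]_n) i j : proj v i j = v i 0 * (v j 0)^*%C.
Proof. by rewrite /proj mxE big_ord1 !mxE. Qed.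

Lemma minor3_ent rho (x y z : 'I_(2 * 2)) : \rank rho = 2%N ->
  rho x x * (rho y y * rho z z - rho y z * rho z y)
  - rho x y * (rho y x * rho z z - rho y z * rho z x)
  + rho x z * (rho y x * rho z y - rho y y * rho z x) = 0.
Proof.
move=> rk; pose f (k : 'I_3) := nth x [:: x; y; z] k.
by have := @minor3_eq0 _ _ _ rho f f; rewrite rk det_mx33 !mxE; apply.
Qed.

Lemma matrix_entP (A B : 'M[C]_(2 * 2)) :
  (forall i a j b, ent A i a j b = ent B i a j b) -> A = B.
Proof.
move=> AB; apply/matrixP => x y.
by case: (mxtens_indexP x) => i a; case: (mxtens_indexP y) => j b.
Qed.

Lemma forall_ord2 (P : 'I_2 -> Prop) : P 0 -> P 1 -> forall i, P i.
Proof.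
move=> P0 P1 [[|[|//]] i2].
  by have -> : Ordinal i2 = 0 by apply: val_inj.
by have -> : Ordinal i2 = 1 by apply: val_inj.
Qed.

Lemma rank2_isotropic rho (t : 'I_3 -> R) :
  (forall x y, (rho y x)^*%C = rho x y) ->
  maximally_mixed_marginal rho ->
  (forall i j, correlation_mx rho i j = t i *+ (i == j)) ->
  t 0 = t 1 -> t 1 = t 2 -> \rank rho = 2%N ->
  rho = 1%:M *t mxtens_block rho 0 0.
Proof.
move=> herm ptr corr t01 t12 rk.
have [s [p [q [[e11 e12 e13 e14] [e21 e22 e23 e24]
               [e31 e32 e33 e34] [e41 e42 e43 e44]]]]] :=
  canonical_entries herm ptr corr.
rewrite {}t01 {}t12 in e11 e14 e22 e23 e32 e33 e41 e44.
move: (t 2) e11 e14 e22 e23 e32 e33 e41 e44.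
move=> {t corr} t e11 e14 e22 e23 e32 e33 e41 e44.
pose entE := (e11, e12, e13, e14, e21, e22, e23, e24,
              e31, e32, e33, e34, e41, e42, e43, e44).
(* At t = 0 the off-diagonal blocks vanish and the two diagonal blocks agree, which is the product
   form. *)
suff t0 : t = 0.
  apply: matrix_entP => i a j b; rewrite tensmxE !mxE.
  move: i a j b; do 4! apply: forall_ord2;
    rewrite /= ?(mul0r, mul1r) //
      ?entE ?t0 ?(subrr, addr0, subr0, add0r, mul0r) //.
pose m00 := mxtens_index ((0 : 'I_2), (0 : 'I_2)).
pose m01 := mxtens_index ((0 : 'I_2), (1 : 'I_2)).
pose m10 := mxtens_index ((1 : 'I_2), (0 : 'I_2)).
pose m11 := mxtens_index ((1 : 'I_2), (1 : 'I_2)).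
have := (minor3_ent m00 m01 m10 rk, minor3_ent m00 m01 m11 rk,
         minor3_ent m00 m10 m11 rk, minor3_ent m01 m10 m11 rk).
rewrite /m00 /m01 /m10 /m11 {m00 m01 m10 m11}.
rewrite !entE.
(* Only the real parts of the four minor equations are kept. *)
move=> [[[[/= + _] [+ _]] [+ _]] [+ _]].
rewrite !(mul0r, mulr0, subr0, addr0, oppr0, add0r) => m1 m2 m3 m4.
case: (@isotropic_minors _ t s p q) => [||||//|[tE sE p0 q0]]; try lra.
clear m1 m2 m3 m4.
(* The remaining case t = -1 is the singlet projector, of rank at most one, against rank two. *)
suff rhoE : rho = proj (singlet R).
  have : (\rank rho <= 1)%N.
    by rewrite rhoE (leq_trans (mxrankM_maxr _ _)) // rank_leq_row.
  by rewrite rk.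
have hh : isqrt2 R * isqrt2 R = (2^-1)%:C.
  by rewrite isqrt2_sq fmorphV rmorph_nat.
have [s1 s2 s3 s4] := singlet_vals R.
apply: matrix_entP => i a j b; rewrite projE singlet_conj.
move: i a j b; do 4! apply: forall_ord2;
  rewrite ?(s1, s2, s3, s4) ?(mulr0, mul0r, mulrN, mulNr, opprK) ?hh
   ?entE ?tE ?sE ?p0 ?q0.
all: apply/eqP; rewrite eq_complex /=; apply/andP; split; apply/eqP.
all: by clear - R; lra.
Qed.

End Rank.

(** * Choi states and local unitaries *)

Section Channels.
Variable R : realType.
Local Notation C := R[i].
Implicit Types (rho : 'M[C]_(2 * 2)) (U V : 'M[C]_2).

Lemma psdmx_proj n (v : 'cV[C]_n) : psdmx (proj v).
Proof.
move=> u; rewrite /proj mulmxA -mulmxA.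
have -> : v^t* *m u = (u^t* *m v)^t* by rewrite trmxC_mul trmxCK.
by rewrite mxE big_ord1 ![(_ ^t*) 0 0]mxE [_^T _ _]mxE; exact: mul_conjC_ge0.
Qed.

Lemma id_tensE m n (L : 'M[C]_n -> 'M[C]_n) (X : 'M[C]_(m * n)) i a j b :
  ent (id_tens L X) i a j b = L (mxtens_block X i j) a b.
Proof.
rewrite /id_tens summxE (bigD1 i) //= summxE (bigD1 j) //=.
rewrite tensmxE mxE !eqxx mul1r.
rewrite !big1 ?addr0 // => k /negPf nk.
  by rewrite summxE big1 // => l _; rewrite tensmxE mxE eq_sym nk mul0r.
by rewrite tensmxE mxE [j == k]eq_sym nk andbF mul0r.
Qed.

Lemma Phi1E (i j : 'I_2) :
  Phi1 R (mxtens_index (i, j)) 0 = isqrt2 R * (i == j)%:R.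
Proof.
rewrite /Phi1 [LHS]mxE [X in _ * X]mxE !tens_colE !mxE !andbT -!natrM !mulnb.
by congr (_ * _); move: i j; do 2 apply: forall_ord2; rewrite /= ?addr0 ?add0r.
Qed.

Lemma mxtens_blockE m n (X : 'M[C]_(m * n)) i j a b :
  mxtens_block X i j a b = ent X i a j b.
Proof. by rewrite mxE. Qed.

(** Tracing out Bob's qubit does not see a trace-preserving map, so Alice's marginal is that of
    [Phi1] itself. *)
Lemma choi_ptr (L : {linear 'M[C]_2 -> 'M[C]_2}) : trace_preserving L ->
  maximally_mixed_marginal (choi_state L).
Proof.
move=> trL i j; rewrite !id_tensE.
have := trL (mxtens_block (proj (Phi1 R)) i j).
rewrite /mxtrace !sum_ord2 => ->.
have cJ (b : nat) : (isqrt2 R * b%:R)^*%C = isqrt2 R * b%:R.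
  by rewrite rmorphM rmorph_nat; congr (_ * _); apply: conjc_real.
have E a : ent (proj (Phi1 R)) i a j a = 2^-1 * ((i == a)%:R * (j == a)%:R).
  by rewrite projE (Phi1E i a) (Phi1E j a) cJ mulrACA isqrt2_sq.
rewrite 2!mxtens_blockE (E 0) (E 1) -mulrDr.
have -> : ((i == j)%:R / 2)%:C = 2^-1 * (i == j)%:R :> C.
  by rewrite rmorphM /= fmorphV !rmorph_nat mulrC.
congr (_ * _); move: i j {E}; do 2 apply: forall_ord2.
all: by rewrite /= ?(mulr0, mulr1, addr0, add0r).
Qed.

Lemma psdmx_choi (L : {linear 'M[C]_2 -> 'M[C]_2}) :
  completely_positive L -> psdmx (choi_state L).
Proof. by move=> cpL; apply: cpL; apply: psdmx_proj. Qed.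

Lemma psdmx_conj n (A W : 'M[C]_n) : psdmx A -> psdmx (W *m A *m W^t*).
Proof.
move=> psdA v; have := psdA (W^t* *m v).
by rewrite trmxC_mul trmxCK !mulmxA.
Qed.

Lemma unitarymx_tens (U V : 'M[C]_2) : U \is unitarymx -> V \is unitarymx ->
  (U *t V : 'M[C]_(2 * 2)) \is unitarymx.
Proof.
move=> /unitarymxP UU /unitarymxP VV; apply/unitarymxP.
rewrite trmxC_tens tensmx_mul UU VV.
apply: matrix_entP => i a j b; rewrite tensmxE !mxE -natrM mulnb.
by rewrite (can_eq (@mxtens_indexK 2 2)) xpair_eqE.
Qed.

Lemma rank_local_conj U V rho : U \is unitarymx -> V \is unitarymx ->
  \rank (local_conj U V rho) = \rank rho.
Proof.
move=> UU VV; have W := unitarymx_tens UU VV.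
rewrite /local_conj mxrankMfree ?row_free_unit ?unitarymx_unit ?trmxC_unitary //.
rewrite -mxrank_tr trmx_mul mxrankMfree ?mxrank_tr //.
by rewrite row_free_unit unitmx_tr unitarymx_unit.
Qed.

Lemma local_conjK U V rho : U \is unitarymx -> V \is unitarymx ->
  local_conj (U^t* ) (V^t* ) (local_conj U V rho) = rho.
Proof.
move=> UU VV; have W := unitarymx_tens UU VV.
rewrite /local_conj -trmxC_tens trmxCK; set X := U *t V.
have XX : X^t* *m X = 1%:M by apply: unitarymx_mulV.
by rewrite !mulmxA XX mul1mx -mulmxA XX mulmx1.
Qed.

Lemma local_conj_tens U V (A B : 'M[C]_2) :
  local_conj U V (A *t B) = (U *m A *m U^t*) *t (V *m B *m V^t*).
Proof. by rewrite /local_conj trmxC_tens !tensmx_mul. Qed.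

Lemma mxtrace_unitary_conj n (V B : 'M[C]_n) : V \is unitarymx ->
  \tr (V *m B *m V^t*) = \tr B.
Proof.
move=> VV; rewrite mxtrace_mulC mulmxA.
by rewrite unitarymx_mulV // mul1mx.
Qed.

(** V disappears under the trace over Bob's qubit, and U fixes I / 2. *)
Lemma local_conj_ptr U V rho : U \is unitarymx -> V \is unitarymx ->
  maximally_mixed_marginal rho ->
  maximally_mixed_marginal (local_conj U V rho).
Proof.
move=> UU VV ptr i j.
have VV1 := unitarymx_mulV VV.
have V_ k l : (V 0 k)^*%C * V 0 l + (V 1 k)^*%C * V 1 l = (k == l)%:R.
  by move/matrixP/(_ k l): VV1; rewrite !mxE sum_ord2 !mxE.
have U_ : U i 0 * (U j 0)^*%C + U i 1 * (U j 1)^*%C = (i == j)%:R.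
  by move/unitarymxP/matrixP/(_ i j): UU; rewrite !mxE sum_ord2 !mxE.
rewrite /local_conj trmxC_tens.
have E a : ent ((U *t V) *m rho *m (U^t* *t V^t*)) i a j a =
  \sum_(l < 2) \sum_(d < 2) (\sum_(k < 2) \sum_(b < 2)
    U i k * V a b * ent rho k b l d) * ((U j l)^*%C * (V a d)^*%C).
  rewrite mxE sum_mxtens_index; apply: eq_bigr => l _; apply: eq_bigr => d _.
  rewrite mxE sum_mxtens_index tensmxE !mxE; congr (_ * _).
  by apply: eq_bigr => k _; apply: eq_bigr => b _; rewrite tensmxE.
(* W is the product of the adjoint of V with V, hence the identity, and T k l collapses to an entry
   of Alice's marginal of rho. *)
pose W d b := (V 0 d)^*%C * V 0 b + (V 1 d)^*%C * V 1 b.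
pose T k l := ent rho k 0 l 0 * W 0 0 + ent rho k 1 l 0 * W 0 1
  + ent rho k 0 l 1 * W 1 0 + ent rho k 1 l 1 * W 1 1.
transitivity (U i 0 * (U j 0)^*%C * T 0 0 + U i 0 * (U j 1)^*%C * T 0 1
  + U i 1 * (U j 0)^*%C * T 1 0 + U i 1 * (U j 1)^*%C * T 1 1).
  by rewrite !E !sum_ord2 /T /W; ring.
have TE k l : T k l = 2^-1 * (k == l)%:R.
  rewrite /T /W !V_ /= !mulr0 !mulr1 !addr0 ptr.
  by rewrite rmorphM /= fmorphV !rmorph_nat mulrC.
rewrite !TE rmorphM /= fmorphV !rmorph_nat -U_; ring.
Qed.

(** Alice's half carries no correlation with P, and the corrections twirl P to a multiple of I, so
    the input has no influence. *)
Lemma teleport_fidelity_tens1 (P : 'M[C]_2) (theta phi : R) :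
  teleport_fidelity (1%:M *t P) (bloch_ket theta phi) = complex.Re (\tr P).
Proof.
rewrite teleport_fidelity_bloch !tensmxE !mxE /= !(mul0r, mul1r) /mxtrace sum_ord2.
move: (P 0 0) (P 1 1) => [a a'] [b b'] /=; rewrite sin2cos2.
by field.
Qed.
End Channels.

(** * Maximal fidelity, fidelity deviation and the conclusion *)

(** Local unitaries keep the form I (x) P and the trace of P, so the supremum runs over a single
    value. *)
Lemma max_average_fidelity_tens1 (R : realType) (P : 'M[R[i]]_2) :
  max_average_fidelity (1%:M *t P) = complex.Re (\tr P).
Proof.
rewrite /max_average_fidelity -[RHS]sup1; congr sup.
have E U V : U \is unitarymx -> V \is unitarymx ->
    average_fidelity (local_conj U V (1%:M *t P)) = complex.Re (\tr P).
  move=> UU VV; apply: pure_average_cst => theta phi.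
  rewrite local_conj_tens mulmx1 (unitarymxP UU) teleport_fidelity_tens1.
  by rewrite mxtrace_unitary_conj.
apply/seteqP; split=> [f [U [V [UU VV ->]]]|f ->] /=; first exact: E.
have U1 : (1%:M : 'M[R[i]]_2) \is unitarymx.
  by apply/unitarymxP; rewrite trmxC1 mulmx1.
by exists 1%:M, 1%:M; rewrite E.
Qed.

Lemma fidelity_std_isotropic (R : realType) (rho : 'M[R[i]]_(2 * 2))
    (t : 'I_3 -> R) :
  (forall x y, (rho y x)^*%C = rho x y) ->
  maximally_mixed_marginal rho ->
  (forall i j, correlation_mx rho i j = t i *+ (i == j)) ->
  fidelity_std rho = 0 -> t 0 = t 1 /\ t 1 = t 2.
Proof.
move=> herm ptr corr.
have [s [p [q [[e11 _ _ e14] [_ e22 e23 _] [_ e32 e33 _] [e41 _ _ e44]]]]] :=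
  canonical_entries herm ptr corr.
(* The fidelity is 1/2 minus half the quadratic form of diag(t) at the Bloch vector. The average
   stays unevaluated inside [a]: the square it produces only has to be nonnegative. *)
pose a := 2^-1 - average_fidelity rho.
rewrite /fidelity_std (@pure_average_variance _ _ a (t 0) (t 1) (t 2)).
  (* A vanishing square root only bounds its argument above by 0; being a sum of squares, the
     argument then vanishes term by term. *)
  move/eqP; rewrite sqrtr_eq0 => h; have h0 := sqr_ge0 (a - (t 0 + t 1 + t 2) / 6).
  have := (sqr_ge0 (t 0 - t 1), sqr_ge0 (t 1 - t 2), sqr_ge0 (t 0 - t 2)).
  move=> [[h1 h2] h3].
  by split; apply/eqP; rewrite -subr_eq0 -sqrf_eq0; apply/eqP; lra.
move=> theta phi; rewrite teleport_fidelity_bloch.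
rewrite e11 e14 e22 e23 e32 e33 e41 e44 /a /=.
have := (sin2cos2 theta, sin2cos2 phi) => -[-> ->].
by field.
Qed.

Theorem proposition2 (R : realType)
    (Lambda : {linear 'M[R[i]]_2 -> 'M[R[i]]_2})
    (channelL : qubit_channel Lambda)
    (rank2 : \rank (choi_state Lambda) = 2%N) :
  ~ useful_for_UQT (send_half Lambda (proj (Phi1 R))).
Proof.
case: channelL => cpL tpL; rewrite -/(choi_state Lambda).
have psd := psdmx_choi cpL; have ptr := choi_ptr tpL.
move: (choi_state Lambda) rank2 psd ptr => rho rank2 psd ptr.
case=> F_gt [_ [[U [V [UU VV ->]]] [t [lam [_ _ Tdiag]]]] /esym std0].
pose tau k := lam k * t k.
have ptrC := local_conj_ptr UU VV ptr.
have hermC x y : (local_conj U V rho y x)^*%C = local_conj U V rho x y.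
  exact/psdmx_hermitian/psdmx_conj.
have corrC i j : correlation_mx (local_conj U V rho) i j = tau i *+ (i == j).
  by rewrite Tdiag !mxE; case: eqVneq => [->|].
have [t01 t12] := fidelity_std_isotropic hermC ptrC corrC std0.
have rkC : \rank (local_conj U V rho) = 2%N by rewrite rank_local_conj.
have := rank2_isotropic hermC ptrC corrC t01 t12 rkC.
(* Undoing the canonical unitaries preserves the product form, so rho itself is I (x) Q. *)
move: (mxtens_block _ 0 0) => P /(congr1 (local_conj (U^t* ) (V^t* ))).
rewrite local_conjK // local_conj_tens mulmx1 trmxCK.
rewrite unitarymx_mulV //.
move: (_ *m _ *m _) => Q rhoQ.
(* The trace of Q is the (0, 0) entry of Alice's marginal I / 2. *)
have trQ : complex.Re (\tr Q) = 2^-1.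
  have := ptr 0 0; rewrite rhoQ !tensmxE !mxE /= !mul1r /mxtrace sum_ord2.
  by move=> ->.
move: F_gt; rewrite rhoQ max_average_fidelity_tens1 trQ; lra.
Qed.
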